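(* Let $A$ be a finite set with $|A|\ge 4$. Then the lattice $\mathcal{E}$ has none of the following properties: $0$-modular, $1$-modular, lower semimodular, upper semimodular.
   Context: $\operatorname{Eq}(A)$ is the set of all equivalence relations on $A$. A mapping $f\colon A\to A$ preserves $\kappa\in\operatorname{Eq}(A)$ if $(x,y)\in\kappa$ implies $(f(x),f(y))\in\kappa$. For $F\subseteq A^A$, $\operatorname{Con}(A,F)$ is the set of all $\kappa\in\operatorname{Eq}(A)$ preserved by every $f\in F$. $\mathcal{E}:=\{\operatorname{Con}(A,F)\mid F\subseteq A^A\}$, ordered by inclusion; it is a finite lattice (meet is intersection; the join of two members is the least member of $\mathcal{E}$ containing both). A bounded lattice is $0$-modular (resp. $1$-modular) if it has no sublattice isomorphic to the pentagon $N_5$ that contains the least element $0$ (resp. the greatest element $1$) of the lattice. With $\prec$ denoting the covering relation, a finite lattice is upper semimodular if $a\wedge b\prec a$ implies $b\prec a\vee b$ for all $a,b$, and lower semimodular if $b\prec a\vee b$ implies $a\wedge b\prec a$ for all $a,b$. *)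

(* Defs.v *)
From HB Require Import structures.
From mathcomp Require Import all_boot all_order.

Set Implicit Arguments.
Unset Strict Implicit.
Unset Printing Implicit Defensive.

Import Order.TTheory.
Local Open Scope order_scope.

(* The pentagon: P0 < Pa < Pb < P1 and P0 < Pc < P1. *)
Variant N5 : Type := P0 | Pa | Pb | Pc | P1.

Definition N5_code (x : N5) : nat :=
  match x with P0 => 0 | Pa => 1 | Pb => 2 | Pc => 3 | P1 => 4 end.

Definition N5_decode (n : nat) : N5 :=
  match n with 0 => P0 | 1 => Pa | 2 => Pb | 3 => Pc | _ => P1 end.

Fact N5_codeK : cancel N5_code N5_decode. Proof. by case. Qed.

HB.instance Definition _ := Countable.copy N5 (can_type N5_codeK).

Fact N5_enumP : Finite.axiom [:: P0; Pa; Pb; Pc; P1]. Proof. by case. Qed.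

HB.instance Definition _ := isFinite.Build N5 N5_enumP.

Definition N5_le (x y : N5) : bool :=
  match x, y with
  | P0, _ | _, P1 | Pa, Pa | Pa, Pb | Pb, Pb | Pc, Pc => true
  | _, _ => false
  end.

Definition N5_meet (x y : N5) : N5 :=
  match x, y with
  | P1, z | z, P1 => z
  | Pa, Pa | Pa, Pb | Pb, Pa => Pa
  | Pb, Pb => Pb
  | Pc, Pc => Pc
  | _, _ => P0
  end.

Definition N5_join (x y : N5) : N5 :=
  match x, y with
  | P0, z | z, P0 => z
  | Pa, Pa => Pa
  | Pa, Pb | Pb, Pa | Pb, Pb => Pb
  | Pc, Pc => Pc
  | _, _ => P1
  end.

Fact N5_le_refl : reflexive N5_le. Proof. by case. Qed.
Fact N5_le_anti : antisymmetric N5_le. Proof. by do 2!case. Qed.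
Fact N5_le_trans : transitive N5_le. Proof. by do 3!case. Qed.

HB.instance Definition _ :=
  Order.Le_isPOrder.Build (Order.Disp tt tt) N5
    N5_le_refl N5_le_anti N5_le_trans.

Fact N5_meetP (x y z : N5) : (x <= N5_meet y z) = (x <= y) && (x <= z).
Proof. by case: x; case: y; case: z. Qed.

Fact N5_joinP (x y z : N5) : (N5_join x y <= z) = (x <= z) && (y <= z).
Proof. by case: x; case: y; case: z. Qed.

HB.instance Definition _ :=
  Order.POrder_MeetJoin_isLattice.Build (Order.Disp tt tt) N5
    N5_meetP N5_joinP.

Definition sublattice d (L : latticeType d) (S : {pred L}) : Prop :=
  Order.ClosedPredicates.meet_closed S /\
  Order.ClosedPredicates.join_closed S.

Definition isomorphic_to_N5 d (L : latticeType d) (S : {pred L}) : Prop :=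
  exists f : N5 -> L,
    [/\ injective f, (forall x : L, x \in S <-> exists p : N5, f p = x),
        Order.meet_morphism f & Order.join_morphism f].

Definition zero_modular d (L : tbLatticeType d) : Prop :=
  ~ exists S : {pred L},
      [/\ sublattice S, isomorphic_to_N5 S & \bot \in S].

Definition one_modular d (L : tbLatticeType d) : Prop :=
  ~ exists S : {pred L},
      [/\ sublattice S, isomorphic_to_N5 S & \top \in S].

Definition covered_by d (L : porderType d) (x y : L) : Prop :=
  x < y /\ ~ exists z : L, x < z < y.

Definition upper_semimodular d (L : finLatticeType d) : Prop :=
  forall a b : L, covered_by (a `&` b) a -> covered_by b (a `|` b).

Definition lower_semimodular d (L : finLatticeType d) : Prop :=
  forall a b : L, covered_by b (a `|` b) -> covered_by (a `&` b) a.

Section CongruenceLattices.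

Variable A : finType.

Definition Eq : {set {set A * A}} :=
  [set k : {set A * A} |
    [&& [forall x, (x, x) \in k],
        [forall x, forall y, ((x, y) \in k) ==> ((y, x) \in k)]
      & [forall x, forall y, forall z,
           ((x, y) \in k) && ((y, z) \in k) ==> ((x, z) \in k)]]].

Definition preserves (f : {ffun A -> A}) (k : {set A * A}) : bool :=
  [forall x, forall y, ((x, y) \in k) ==> ((f x, f y) \in k)].

Definition Con (F : {set {ffun A -> A}}) : {set {set A * A}} :=
  [set k in Eq | [forall f in F, preserves f k]].

Definition conE : {set {set {set A * A}}} :=
  [set Con F | F : {set {ffun A -> A}}].

Record con_lattice : Type :=
  ConLattice { con_val :> {set {set A * A}}; _ : con_val \in conE }.

HB.instance Definition _ := [isSub for con_val].
HB.instance Definition _ := [Finite of con_lattice by <:].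

Definition con_le (X Y : con_lattice) : bool := con_val X \subset con_val Y.

Fact con_le_refl : reflexive con_le. Proof. by move=> X; apply: subxx. Qed.

Fact con_le_anti : antisymmetric con_le.
Proof. by move=> X Y XY; apply/val_inj/eqP; rewrite eqEsubset. Qed.

Fact con_le_trans : transitive con_le.
Proof. by move=> Y X Z; apply: subset_trans. Qed.

HB.instance Definition _ :=
  Order.Le_isPOrder.Build (Order.Disp tt tt) con_lattice
    con_le_refl con_le_anti con_le_trans.

Lemma mem_Con F k :
  (k \in Con F) = (k \in Eq) && [forall f in F, preserves f k].
Proof. by rewrite inE. Qed.

Lemma Con_in_conE F : Con F \in conE. Proof. exact: imset_f. Qed.

Lemma ConU F G : Con (F :|: G) = Con F :&: Con G.
Proof.
apply/setP => k; rewrite in_setI !mem_Con; case: (k \in Eq) => //=.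
apply/forall_inP/andP => [H | [/forall_inP HF /forall_inP HG] f].
  by split; apply/forall_inP => f fin; apply: H; rewrite inE fin ?orbT.
by rewrite inE => /orP[/HF | /HG].
Qed.

Lemma Con0 : Con set0 = Eq.
Proof.
apply/setP => k; rewrite mem_Con andbC.
by case: forall_inP => //; case=> f; rewrite inE.
Qed.

Lemma conE_setI X Y : X \in conE -> Y \in conE -> X :&: Y \in conE.
Proof.
by move=> /imsetP[F _ ->] /imsetP[G _ ->]; rewrite -ConU Con_in_conE.
Qed.

Definition con_meet (X Y : con_lattice) : con_lattice :=
  ConLattice (conE_setI (valP X) (valP Y)).

Fact con_meetP (X Y Z : con_lattice) :
  (X <= con_meet Y Z) = (X <= Y) && (X <= Z).
Proof. exact: subsetI. Qed.

Lemma Eq_in_conE : Eq \in conE. Proof. by rewrite -Con0 Con_in_conE. Qed.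

Lemma conE_sub_Eq X : X \in conE -> X \subset Eq.
Proof. by case/imsetP=> F _ ->; apply/subsetP => k; rewrite mem_Con => /andP[]. Qed.

Definition con_join_set (X Y : con_lattice) : {set {set A * A}} :=
  \bigcap_(Z in conE | (con_val X \subset Z) && (con_val Y \subset Z)) Z.

Lemma con_join_subproof X Y : con_join_set X Y \in conE.
Proof.
have <-: Eq :&: con_join_set X Y = con_join_set X Y.
  apply/setIidPr/(bigcap_inf Eq).
  by rewrite Eq_in_conE !conE_sub_Eq //; apply: valP.
apply: (big_rec (fun W => Eq :&: W \in conE)) => [|Z W /andP[ZE _] WE].
  by rewrite setIT Eq_in_conE.
by rewrite setICA; apply: conE_setI.
Qed.

Definition con_join (X Y : con_lattice) : con_lattice :=
  ConLattice (con_join_subproof X Y).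

Fact con_joinP (X Y Z : con_lattice) :
  (con_join X Y <= Z) = (X <= Z) && (Y <= Z).
Proof.
have ubX : con_val X \subset con_join_set X Y.
  by apply/bigcapsP => W /and3P[].
have ubY : con_val Y \subset con_join_set X Y.
  by apply/bigcapsP => W /and3P[].
apply/idP/andP => [XYZ | [XZ YZ]].
  by split; [apply: subset_trans ubX XYZ | apply: subset_trans ubY XYZ].
by apply: bigcap_inf; apply/and3P; split=> //; apply: valP.
Qed.

HB.instance Definition _ :=
  Order.POrder_MeetJoin_isLattice.Build (Order.Disp tt tt) con_lattice
    con_meetP con_joinP.

Definition con_bot : con_lattice := ConLattice (Con_in_conE setT).
Definition con_top : con_lattice := ConLattice Eq_in_conE.

Fact con_le0x (X : con_lattice) : con_bot <= X.
Proof.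
have /imsetP[F _ defX] := valP X; apply/subsetP => k.
rewrite [con_val X]defX !mem_Con => /andP[-> /forall_inP kT].
by apply/forall_inP => f _; apply: kT; rewrite inE.
Qed.

Fact con_lex1 (X : con_lattice) : X <= con_top.
Proof. exact: conE_sub_Eq (valP X). Qed.

HB.instance Definition _ :=
  Order.hasBottom.Build (Order.Disp tt tt) con_lattice con_le0x.
HB.instance Definition _ :=
  Order.hasTop.Build (Order.Disp tt tt) con_lattice con_lex1.

End CongruenceLattices.

(* Main.v *)
Require Import Defs.
From mathcomp Require Import all_boot all_order.

Set Implicit Arguments.
Unset Strict Implicit.
Unset Printing Implicit Defensive.

Import Order.TTheory.

(** Write [E] for the lattice of congruence lattices on [A], and for a subset
    [B] of [A] let [collapse B] be the equivalence whose only nontrivial class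
    is [B].  Take four distinct points [s], [t], [u], [v] of [A].

    A chain of subsets of [A] containing the empty set and [A] gives a member
    of [E] ([chain_conE]).  So [a := {0, collapse {s,u}, 1}] and
    [b := {0, collapse {s,u}, collapse {s,u,v}, 1}] belong to [E], where [0]
    and [1] are the equality and the full relation.  Let [c] be the set of all
    equivalences in which [s] is alone in its class or equivalent to [t].  It
    is the congruence lattice of a single map, and it is a coatom of [E]
    ([hook_coatom]).  Both [b] and [c] contain [0] and [1], but neither
    nontrivial element of [b] lies in [c].  Hence [b] meets [c] in the least
    element of [E], and [a] joins [c] to the greatest: together with [a < b],
    this is a pentagon through the bottom and the top of [E], which refutes
    0-modularity and 1-modularity at once.  As [c] is covered by the top while
    the interval from the bottom to [b] contains [a], the pair [b], [c] also
    refutes lower semimodularity.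

    For upper semimodularity, keep the atom [a] and take the atom
    [c' := {0, collapse {s,v}, 1}].  A congruence lattice that contains
    [collapse {s,u}] and [collapse {s,v}] contains their join
    [collapse {s,u,v}] ([collapse_join]), so
    [{0, collapse {s,v}, collapse {s,u,v}, 1}] lies strictly between [c'] and
    the join of [a] and [c']. *)

(** * Pentagons from three elements *)

Section Pentagon.

Local Open Scope order_scope.

Variables (d : Order.disp_t) (L : latticeType d) (a b c : L).

Definition pentagon_map (p : N5) : L :=
  match p with
  | P0 => b `&` c | Pa => a | Pb => b | Pc => c | P1 => a `|` c
  end.

Hypotheses (ab : a < b) (bca : b `&` c <= a) (bac : b <= a `|` c).

(* Every inequality that should fail between the five elements reduces to
   one of these three, so [pentagon_map] is an order embedding. *)
Let ba_false : (b <= a) = false. Proof. exact: lt_geF. Qed.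

Let ac_false : (a <= c) = false.
Proof.
apply/negP => ac; have bc : b <= c by rewrite (le_trans bac) // leUx ac lexx.
by move: ba_false; rewrite (le_trans _ bca) // lexI lexx.
Qed.

Let cb_false : (c <= b) = false.
Proof.
apply/negP => cb; have ca : c <= a by rewrite (le_trans _ bca) // lexI cb lexx.
by move: ba_false; rewrite (le_trans bac) // leUx ca lexx.
Qed.

Let meetE : Order.meet_morphism pentagon_map.
Proof.
have le_ab := ltW ab.
have acE : a `&` c = b `&` c.
  by apply/le_anti; rewrite leI2 //= lexI bca leIr.
have [aU cU] : a <= a `|` c /\ c <= a `|` c by rewrite leUl leUr.
have [b0 c0] : b `&` c <= b /\ b `&` c <= c by rewrite leIl leIr.
have c01 : b `&` c <= a `|` c := le_trans bca aU.
have ca : c `&` a = b `&` c by rewrite meetC.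
by case; case; rewrite /= ?meetxx ?acE ?ca ?[c `&` b]meetC //;
  apply/esym; first [exact: meet_l | exact: meet_r].
Qed.

Let joinE : Order.join_morphism pentagon_map.
Proof.
have le_ab := ltW ab.
have bcE : b `|` c = a `|` c.
  by apply/le_anti; rewrite leUx bac leUr /= leU2.
have [aU cU] : a <= a `|` c /\ c <= a `|` c by rewrite leUl leUr.
have [b0 c0] : b `&` c <= b /\ b `&` c <= c by rewrite leIl leIr.
have c01 : b `&` c <= a `|` c := le_trans bca aU.
have cb : c `|` b = a `|` c by rewrite joinC.
by case; case; rewrite /= ?joinxx ?bcE ?cb ?[c `|` a]joinC //;
  apply/esym; first [exact: join_l | exact: join_r].
Qed.

Let pentagon_map_inj : injective pentagon_map.
Proof.
have bc_false : (b <= c) = false.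
  by apply: contraFF ac_false => bc; apply: le_trans (ltW ab) bc.
have ca_false : (c <= a) = false.
  by apply: contraFF cb_false => ca; apply: le_trans ca (ltW ab).
have cancel_le p q : pentagon_map p <= pentagon_map q -> N5_le p q.
  by case: p; case: q;
    rewrite //= ?leUx ?lexI ?ba_false ?ac_false ?cb_false ?bc_false ?ca_false ?andbF.
move=> p q pq; apply: N5_le_anti.
by rewrite !cancel_le // pq lexx.
Qed.

(** The hypotheses force [a `&` c = b `&` c] and [a `|` c = b `|` c], so the
    five elements are closed under both operations; none of them coincide
    because each coincidence would collapse [a] and [b]. *)
Lemma pentagon_sublattice :
  exists S : {pred L},
    [/\ sublattice S, isomorphic_to_N5 S, b `&` c \in S & a `|` c \in S].
Proof.
pose S : {pred L} := [pred x | [exists p, pentagon_map p == x]].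
have inS p : pentagon_map p \in S by apply/existsP; exists p.
have SP x : x \in S <-> exists p, pentagon_map p = x.
  split; first by case/existsP => p /eqP <-; exists p.
  by case=> p <-.
exists S; split; [ split | | exact: (inS P0) | exact: (inS P1) ].
- by move=> _ _ /SP[p <-] /SP[q <-]; rewrite -meetE.
- by move=> _ _ /SP[p <-] /SP[q <-]; rewrite -joinE.
- by exists pentagon_map; split.
Qed.

End Pentagon.

Section CongruenceLattices.

Variable A : finType.
Implicit Types (B D E : {set A}) (k : {set A * A}) (X : con_lattice A).

(** * Equivalences with a single nontrivial class *)

Lemma fresh (s : seq A) : size s < #|A| -> exists x, x \notin s.
Proof.
move=> ltsA; apply/existsP; rewrite -negb_forall; apply: contraL ltsA.
move=> /forallP sA; rewrite -leqNgt (leq_trans _ (card_size s)) //.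
by apply/subset_leq_card/subsetP => x _; apply: sA.
Qed.

Lemma EqP k :
  reflect [/\ forall x, (x, x) \in k,
              forall x y, (x, y) \in k -> (y, x) \in k
            & forall x y z, (x, y) \in k -> (y, z) \in k -> (x, z) \in k]
          (k \in Eq A).
Proof.
rewrite inE; apply: (iffP and3P) => [[r s t] | [r s t]]; split.
- exact/forallP.
- by move=> x y; move/forallP/(_ x)/forallP/(_ y)/implyP: s.
- move=> x y z xy yz.
  by move/forallP/(_ x)/forallP/(_ y)/forallP/(_ z)/implyP: t; apply; apply/andP.
- exact/forallP.
- by do 2!apply/forallP => ?; apply/implyP/s.
- by do 3!apply/forallP => ?; apply/implyP => /andP[]; apply: t.
Qed.

Lemma preservesP (f : {ffun A -> A}) k :
  reflect (forall x y, (x, y) \in k -> (f x, f y) \in k) (preserves f k).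
Proof.
apply: (iffP forallP) => [H x y | H x].
  by move/forallP/(_ y)/implyP: (H x).
by apply/forallP => y; apply/implyP/H.
Qed.

Lemma ConP (F : {set {ffun A -> A}}) k :
  reflect (k \in Eq A /\ {in F, forall f, preserves f k}) (k \in Con F).
Proof. by rewrite mem_Con; apply: (iffP andP) => -[? /forall_inP]. Qed.

Definition collapse B : {set A * A} :=
  [set p | (p.1 == p.2) || (p.1 \in B) && (p.2 \in B)].

Lemma in_collapse B x y :
  ((x, y) \in collapse B) = (x == y) || (x \in B) && (y \in B).
Proof. by rewrite inE. Qed.

Lemma collapse_Eq B : collapse B \in Eq A.
Proof.
apply/EqP; split=> [x | x y | x y z]; rewrite !in_collapse ?eqxx //.
  by rewrite eq_sym andbC.
case: eqP => [-> | _] //= /andP[-> yB].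
by case: eqP => [<- _ | _ /andP[_ ->]]; rewrite ?yB orbT.
Qed.

Lemma preserves_collapse2 (f : {ffun A -> A}) x y :
  preserves f (collapse [set x; y]) ->
  [\/ f x = f y, f x = x /\ f y = y | f x = y /\ f y = x].
Proof.
move/preservesP/(_ x y); rewrite !in_collapse !inE !eqxx !orbT => /(_ isT).
have [| fxy] := eqVneq (f x) (f y); first by constructor 1.
case/andP=> /orP[]/eqP fx /orP[]/eqP fy; do [by rewrite fx fy eqxx in fxy | ].
  by constructor 2.
by constructor 3.
Qed.

(** Subsets with at most one element all collapse to the equality relation,
    whence the bound on the size of [B]; [D] inherits it. *)
Lemma collapse_inj B D : 1 < #|B| -> collapse B = collapse D -> B = D.
Proof.
case/card_gt1P=> x [y [xB yB xy]] eqBD.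
have inD z w : z \in B -> w \in B -> z != w -> z \in D.
  move=> zB wB zw; have: (z, w) \in collapse D by rewrite -eqBD inE zB wB orbT.
  by rewrite in_collapse (negPf zw) => /andP[].
apply/setP => z; apply/idP/idP => [zB | zD].
  by have [->|zx] := eqVneq z x; [apply: inD xy | apply: inD zx].
have [-> // | zx] := eqVneq z x.
have: (z, x) \in collapse B by rewrite eqBD inE zD (inD x y) ?orbT.
by rewrite in_collapse (negPf zx) => /andP[].
Qed.

(** * Chains as congruence lattices *)

Definition step (x p q : A) : {ffun A -> A} := [ffun z => if z == x then p else q].

Lemma step_preserves_collapse x p q B :
  x \notin B \/ p \in B /\ q \in B -> preserves (step x p q) (collapse B).
Proof.
move=> H; apply/preservesP => y z; rewrite !in_collapse !ffunE.
case/orP=> [/eqP-> | /andP[yB zB]]; first by rewrite eqxx.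
case: H => [xB | [pB qB]].
  by rewrite !ifN ?eqxx //; apply: contraNneq xB => <-.
by apply/orP; right; apply/andP; split; case: ifP.
Qed.

(** Let [F] consist of all maps that preserve [collapse B] for every [B] in
    the chain, and let [k] be an equivalence preserved by [F].  If [B] is the
    least member of the chain with [k] below [collapse B], and [D] its
    predecessor, then [k] relates two distinct points one of which, say [x], is
    outside [D].  The map sending [x] to [p] and all else to [q], for [p], [q]
    in [B], is in [F]: members of the chain inside [D] avoid [x], the others
    contain [p] and [q].  So [k] relates all [p] and [q] in [B], that is,
    [k = collapse B]. *)
Lemma chain_conE (C : {set {set A}}) :
    set0 \in C -> setT \in C ->
    {in C &, forall B D, (B \subset D) || (D \subset B)} ->
  [set collapse B | B in C] \in conE A.
Proof.
move=> C0 CT totC.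
pose F := [set f | [forall B in C, preserves f (collapse B)]].
suff ->: [set collapse B | B in C] = Con F by apply: Con_in_conE.
apply/eqP; rewrite eqEsubset; apply/andP; split; apply/subsetP => k.
  case/imsetP=> B BC ->; apply/ConP; split; first exact: collapse_Eq.
  by move=> f; rewrite inE => /forall_inP; apply.
case/ConP=> /EqP[krefl ksym ktrans] kF.
have kT : [pred B in C | k \subset collapse B] setT.
  by rewrite /= CT; apply/subsetP=> -[x y] _; rewrite in_collapse !inE orbT.
have [B /andP[BC kB] minB] := arg_minnP (fun B => #|B|) kT.
suff: collapse B \subset k.
  by move=> Bk; apply/imsetP; exists B => //; apply/eqP; rewrite eqEsubset kB.
(* The empty set has no predecessor in the chain. *)
have [B0 | Bn0] := eqVneq B set0.
  apply/subsetP => -[x y]; rewrite in_collapse B0 !inE orbF => /eqP->.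
  exact: krefl.
have D0 : [pred B' in C | B' \proper B] set0 by rewrite /= C0 proper0.
have [D /andP[DC DB] maxD] := arg_maxnP (fun B => #|B|) D0.
have [x [y [xy kxy xD]]] : exists x y, [/\ x != y, (x, y) \in k & x \notin D].
  have: ~~ (k \subset collapse D).
    apply: contraL (proper_card DB) => kD.
    by rewrite -leqNgt; apply: minB; rewrite /= DC.
  case/subsetPn=> -[x y] kxy; rewrite in_collapse negb_or negb_and.
  case/andP=> xy /orP[xD | yD]; first by exists x, y.
  by exists y, x; rewrite eq_sym ksym.
apply/subsetP => -[p q]; rewrite in_collapse => /orP[/eqP-> // | /andP[pB qB]].
have stepF : step x p q \in F.
  rewrite inE; apply/forall_inP => B' B'C; apply: step_preserves_collapse.
  have [BB' | B'B] := boolP (B \subset B').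
    by right; rewrite !(subsetP BB').
  have ltB'B : B' \proper B.
    by rewrite properE B'B andbT; move: (totC _ _ BC B'C); rewrite (negPf B'B).
  left; apply: contra xD => xB'; apply: subsetP xB'.
  case/orP: (totC _ _ DC B'C) => // DB'.
  have /eqP-> // : D == B'.
  by rewrite eqEcard DB'; apply: maxD; rewrite /= B'C.
have /preservesP/(_ _ _ kxy) := kF _ stepF.
by rewrite !ffunE eqxx eq_sym (negPf xy).
Qed.

Lemma chain2_conE B D : B \subset D ->
  [set collapse E | E in [set set0; B; D; setT]] \in conE A.
Proof.
move=> BD; apply: chain_conE; rewrite ?inE ?eqxx ?orbT // => E1 E2.
rewrite !inE -!orbA => /or4P[]/eqP-> /or4P[]/eqP->;
  by rewrite ?sub0set ?subsetT ?subxx ?BD ?orbT.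
Qed.

(** With [B = D] this is the three-element congruence lattice with middle
    element [collapse B], and with both empty it is the least element. *)
Definition con_chain B D (BD : B \subset D) : con_lattice A :=
  ConLattice (chain2_conE BD).

Lemma con_chainP B D (BD : B \subset D) k :
  reflect [\/ k = collapse set0, k = collapse B, k = collapse D
            | k = collapse setT]
          (k \in con_val (con_chain BD)).
Proof.
apply: (iffP imsetP) => [[E] | ].
  by rewrite !inE -!orbA => /or4P[]/eqP-> ->;
    [constructor 1 | constructor 2 | constructor 3 | constructor 4].
by case=> ->; [exists set0 | exists B | exists D | exists setT];
  rewrite // !inE eqxx ?orbT.
Qed.


Lemma collapse_con_chain B D (BD : B \subset D) E : 1 < #|E| ->
  (collapse E \in con_val (con_chain BD)) = [|| E == B, E == D | E == setT].
Proof.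
move=> E1; apply/con_chainP/or3P.
  case=> /(collapse_inj E1) defE.
  - by rewrite defE cards0 in E1.
  - by constructor 1; apply/eqP.
  - by constructor 2; apply/eqP.
  - by constructor 3; apply/eqP.
by case=> /eqP->; [constructor 2 | constructor 3 | constructor 4].
Qed.

Lemma con_leE X Y : (X <= Y)%O = (con_val X \subset con_val Y).
Proof. by []. Qed.

Lemma collapse0T_mem X :
  (collapse set0 \in con_val X) && (collapse setT \in con_val X).
Proof.
have /imsetP[F _ ->] := valP X; rewrite !mem_Con !collapse_Eq /=.
by apply/andP; split; apply/forall_inP => f _; apply/preservesP => x y;
  rewrite !in_collapse !inE ?orbT // !orbF => /eqP->.
Qed.

Lemma con_chain_le B D (BD : B \subset D) X :
  (con_chain BD <= X)%O = (collapse B \in con_val X) && (collapse D \in con_val X).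
Proof.
have /andP[X0 XT] := collapse0T_mem X.
rewrite con_leE; apply/subsetP/andP => [H | [XB XD] k /con_chainP].
  by split; apply: H; apply/con_chainP; [constructor 2 | constructor 3].
by case=> ->.
Qed.

Lemma con_botP k :
  k \in con_val (\bot : con_lattice A)%O -> k = collapse set0 \/ k = collapse setT.
Proof.
have: (\bot <= con_chain (subxx (set0 : {set A})))%O by apply: le0x.
rewrite con_leE => /subsetP/[apply]/con_chainP.
by case; [left | left | left | right].
Qed.

Lemma con_chain_meet0 B D (BD : B \subset D) X :
  collapse B \notin con_val X -> collapse D \notin con_val X ->
  (con_chain BD `&` X = \bot)%O.
Proof.
move=> XB XD; apply/eqP; rewrite -lex0 con_leE; apply/subsetP => k.
case/setIP=> /con_chainP[] -> kX; have /andP[bot0 botT] := collapse0T_mem \bot%O.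
- exact: bot0.
- by rewrite kX in XB.
- by rewrite kX in XD.
- exact: botT.
Qed.

Lemma con_chain_atom B : 1 < #|B| -> B != setT ->
  covered_by \bot%O (con_chain (subxx B)).
Proof.
move=> B1 BT; split.
  rewrite lt0x; apply: contraL BT => /eqP aB.
  have: collapse B \in con_val (\bot : con_lattice A)%O.
    by rewrite -aB collapse_con_chain // eqxx.
  case/con_botP => /(collapse_inj B1) defB; last by rewrite defB eqxx.
  by rewrite defB cards0 in B1.
case=> X /andP[ltX Xlt].
have [XB | XB] := boolP (collapse B \in con_val X).
  by move: (lt_geF Xlt); rewrite con_chain_le XB.
have := con_chain_meet0 (subxx B) XB XB.
by rewrite (meet_r (ltW Xlt)) => X0; rewrite X0 ltxx in ltX.
Qed.

(** A congruence lattice is a sublattice of all equivalences; for this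
    particular join it can be seen on each map [f] in turn: [f] preserves both
    pairs only if it is constant on the three points or maps them among
    themselves. *)
Lemma collapse_join X u v w :
    collapse [set u; v] \in con_val X -> collapse [set u; w] \in con_val X ->
  collapse [set u; v; w] \in con_val X.
Proof.
have /imsetP[F _ ->] := valP X.
case/ConP=> _ Fv /ConP[_ Fw]; apply/ConP; split=> [|f Ff]; first exact: collapse_Eq.
have fv := preserves_collapse2 (Fv f Ff).
have fw := preserves_collapse2 (Fw f Ff).
have [f_const | f_into] : {in [set u; v; w], forall x, f x = f u} \/
    {in [set u; v; w], forall x, f x \in [set u; v; w]}.
  have f_in : f u \in [set u; v; w] -> f v \in [set u; v; w] ->
      f w \in [set u; v; w] -> {in [set u; v; w], forall x, f x \in [set u; v; w]}.
    by move=> Hu Hv Hw x /setUP[/set2P[]-> | /set1P->].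
  case: fv => [/esym ev | [e1 ev] | [e1 ev]].
    case: fw => [/esym ew | [e2 ew] | [e2 ew]].
    - by left=> x; rewrite !inE -orbA => /or3P[]/eqP->.
    - by right; apply: f_in; rewrite ?ev ?e2 ?ew !inE eqxx ?orbT.
    - by right; apply: f_in; rewrite ?ev ?e2 ?ew !inE eqxx ?orbT.
  - right; apply: f_in; rewrite ?e1 ?ev; [by rewrite !inE eqxx ?orbT.. | ].
    by case: fw => [<- | [_ ->] | [_ ->]]; rewrite ?e1 !inE eqxx ?orbT.
  right; apply: f_in; rewrite ?e1 ?ev; [by rewrite !inE eqxx ?orbT.. | ].
  by case: fw => [<- | [_ ->] | [_ ->]]; rewrite ?e1 !inE eqxx ?orbT.
- apply/preservesP => x y; rewrite !in_collapse.
  by case/orP=> [/eqP-> | /andP[/f_const-> /f_const->]]; rewrite eqxx.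
- apply/preservesP => x y; rewrite !in_collapse.
  by case/orP=> [/eqP-> | /andP[/f_into-> /f_into->]]; rewrite ?eqxx ?orbT.
Qed.

(** * A coatom *)

(** The map [step s s t] fixes [s] and sends everything else to [t], so it
    preserves an equivalence exactly when [s] is alone in its class or
    equivalent to [t]. *)
Definition hook (s t : A) : con_lattice A :=
  ConLattice (Con_in_conE [set step s s t]).

Lemma hookP s t k :
  reflect (k \in Eq A /\ forall x, x != s -> (s, x) \in k -> (s, t) \in k)
          (k \in con_val (hook s t)).
Proof.
apply: (iffP (ConP _ _)) => -[kEq H]; split=> //.
  move=> x xs sx; have /preservesP/(_ _ _ sx) := H _ (set11 _).
  by rewrite !ffunE eqxx (negPf xs).
move=> _ /set1P->; apply/preservesP => x y xy; rewrite !ffunE.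
have [r sy _] := EqP _ kEq.
have [xs | xs] := eqVneq x s; have [ys | ys] := eqVneq y s; rewrite ?r //.
  by apply: H ys _; rewrite -xs.
by apply/sy; apply: H xs _; apply: sy; rewrite -ys.
Qed.

Lemma collapse_hook s t B :
  (collapse B \in con_val (hook s t)) =
    [|| s == t, s \notin B, t \in B | B \subset [set s]].
Proof.
apply/hookP/or4P => [[_ H] | H].
  have [-> | st] := eqVneq s t; first by constructor 1.
  have [sB | sB] := boolP (s \in B); last by constructor 2.
  have [Bs | /subsetPn[x xB xs]] := boolP (B \subset [set s]).
    by constructor 4.
  constructor 3; rewrite inE in xs.
  by have := H x xs; rewrite !in_collapse sB xB orbT (negPf st) /=; apply.
split=> [|x xs]; first exact: collapse_Eq.
rewrite !in_collapse eq_sym (negPf xs) /= => /andP[sB xB].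
case: H => [-> // | | -> | /subsetP/(_ x xB)]; rewrite ?sB ?orbT //.
by rewrite inE (negPf xs).
Qed.

(** Two distinct points of [A] minus [s] are merged, fixed or swapped by [f].
    A third point [z] excludes the swap of [x] and [y], since [f x = y] and
    [f y = x] leave no admissible value for [f z]; so a point that moves is
    merged with every other one. *)
Lemma pair_invariant_id_or_const s (f : A -> A) : 3 < #|A| ->
    (forall x y, x != s -> y != s ->
      [\/ f x = f y, f x = x /\ f y = y | f x = y /\ f y = x]) ->
  (forall x, x != s -> f x = x) \/
  (forall x y, x != s -> y != s -> f x = f y).
Proof.
move=> A4 fpair.
have [/forall_inP fid | /forall_inPn[x xs fx]] :=
  boolP [forall (x | x != s), f x == x].
  by left=> x xs; apply/eqP/fid.
suff fxE y : y != s -> f x = f y by right=> y z /fxE <- /fxE <-.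
move=> ys; have [z] := @fresh [:: s; x; y] A4.
rewrite !inE !negb_or => /and3P[zs zx zy].
case: (fpair x y xs ys) => // -[fxy fyx]; first by rewrite fxy eqxx in fx.
have [xy | xy] := eqVneq x y; first by rewrite xy.
case: (fpair x z xs zs) => [fxz | [fxx _] | [fxz _]].
- case: (fpair y z ys zs) => [fyz | [fyy _] | [fyz _]].
  + by rewrite fxz.
  + by rewrite -fyx fyy eqxx in xy.
  + by rewrite -fyx fyz eqxx in zx.
- by rewrite fxx eqxx in fx.
- by rewrite -fxy fxz eqxx in zy.
Qed.

(** Suppose that [g] preserves all members of [hook s t], and also an
    equivalence [k] outside it, with [s] related by [k] to some [x] but not to
    [t].  As [hook s t] contains [collapse {y,z}] for [y], [z] other than [s],
    [g] is the identity or constant off [s].  The pair [{s,t}], also in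
    [hook s t], leaves few choices for [g s]; each one that makes [g] neither
    the identity nor constant would have [k] relate [s] to [t].  So [g]
    preserves every equivalence. *)
Lemma hook_coatom s t X : 3 < #|A| -> s != t ->
  (hook s t <= X)%O -> (X <= hook s t)%O \/ X = \top%O.
Proof.
move=> A4 st hX; have [/subsetP Xh | /subsetPn[k kX kh]] :=
  boolP (con_val X \subset con_val (hook s t)); first by left; apply/subsetP.
right; apply/eqP; rewrite -le1x con_leE.
case/imsetP: (valP X) => F _ defX; rewrite [con_val X]defX in kX *.
case/ConP: kX => /[dup] kEq /EqP[kr ks kt] kF.
have [x [xs sx nst]] : exists x, [/\ x != s, (s, x) \in k & (s, t) \notin k].
  have: ~~ [forall x, (x != s) && ((s, x) \in k) ==> ((s, t) \in k)].
    apply: contra kh => /forallP H; apply/hookP; split=> // x xs sx.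
    by move/implyP: (H x); apply; rewrite xs.
  case/forallPn=> x; rewrite negb_imply => /andP[/andP[xs sx] nst].
  by exists x.
apply/subsetP => e /EqP[er es et]; apply/ConP; split; first exact/EqP.
move=> g Fg; apply/preservesP => y z yz.
have g_hook B : collapse B \in con_val (hook s t) -> preserves g (collapse B).
  by move/(subsetP hX); rewrite [con_val X]defX => /ConP[_]; apply.
have g_pair y' z' : y' != s -> z' != s ->
    [\/ g y' = g z', g y' = y' /\ g z' = z' | g y' = z' /\ g z' = y'].
  move=> ys zs; apply/preserves_collapse2/g_hook.
  by rewrite collapse_hook !inE !(eq_sym s) (negPf ys) (negPf zs) /= orbT.
have g_st : [\/ g s = g t, g s = s /\ g t = t | g s = t /\ g t = s].
  by apply/preserves_collapse2/g_hook; rewrite collapse_hook !inE !eqxx ?orbT.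
have ts : t != s by rewrite eq_sym.
have gsx : (g s, g x) \in k by apply/(preservesP g k _ s x sx); apply: kF.
have [g_id | g_const] := pair_invariant_id_or_const A4 g_pair.
  have gs : g s = s.
    case: g_st => [| [] | []] // gs; last by rewrite (g_id t ts) => /eqP/idPn.
    rewrite gs !g_id // in gsx.
    by case/negP: nst; apply: kt sx (ks _ _ gsx).
  suff gE w : g w = w by rewrite !gE.
  by have [-> // | ws] := eqVneq w s; apply: g_id.
suff gE w : g w = g t by rewrite !gE.
have [-> {w} | ws] := eqVneq w s; last exact: g_const.
case: g_st => // -[gs gt]; case/negP: nst.
  by rewrite gs (g_const x t) // gt in gsx.
by rewrite gs (g_const x t) // gt in gsx; apply: ks.
Qed.

End CongruenceLattices.

(** * The four failures *)

Theorem proposition7p7 (A : finType) (hA : 4 <= #|A|) :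
  [/\ ~ zero_modular (con_lattice A),
      ~ one_modular (con_lattice A),
      ~ lower_semimodular (con_lattice A)
    & ~ upper_semimodular (con_lattice A)].
Proof.
have [s _] := @fresh A [::] (ltn_trans (ltn0Sn 2) hA).
have [t] := @fresh A [:: s] (ltn_trans (isT : 1 < 3) hA).
rewrite inE => ts; have st : s != t by rewrite eq_sym.
have [u] := @fresh A [:: s; t] (ltn_trans (isT : 2 < 3) hA).
rewrite !inE negb_or => /andP[us ut].
have [v] := @fresh A [:: s; t; u] hA.
rewrite !inE !negb_or => /and3P[vs vt vu].
have [su_suv sv_suv] : [set s; u] \subset [set s; u; v] /\
                       [set s; v] \subset [set s; u; v].
  by split; apply/subsetP => x; rewrite !inE => /orP[]->; rewrite ?orbT.
have su1 : 1 < #|[set s; u]| by rewrite cards2 eq_sym us.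
have sv1 : 1 < #|[set s; v]| by rewrite cards2 eq_sym vs.
have suv1 : 1 < #|[set s; u; v]| := leq_trans su1 (subset_leq_card su_suv).
have missing x (B D : {set A}) : x \in D -> x \notin B -> (B == D) = false.
  by move=> xD; apply: contraNF => /eqP->.
have suv_su : ([set s; u; v] == [set s; u]) = false.
  by rewrite eq_sym; apply: (missing v); rewrite !inE ?eqxx ?orbT ?negb_or ?vs.
have suv_sv : ([set s; u; v] == [set s; v]) = false.
  rewrite eq_sym; apply: (missing u); rewrite !inE ?eqxx ?orbT ?negb_or ?us //=.
  by rewrite eq_sym.
have su_sv : ([set s; u] == [set s; v]) = false.
  by apply: (missing v); rewrite !inE ?eqxx ?orbT ?negb_or ?vs.
have suvT : ([set s; u; v] == setT) = false.
  by apply: (missing t); rewrite !inE ?negb_or ?ts ?(eq_sym t) ?ut ?vt.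
have suT : ([set s; u] == setT) = false.
  by apply: (missing t); rewrite !inE ?negb_or ?ts ?(eq_sym t) ?ut ?vt.
pose a := con_chain (subxx [set s; u]).
pose b := con_chain su_suv.
pose c := hook s t.
have ab : (a < b)%O.
  rewrite lt_leAnge !con_chain_le !collapse_con_chain //.
  by rewrite !eqxx suv_su suvT.
have suc : collapse [set s; u] \notin con_val c.
  rewrite collapse_hook (negPf st) !inE eqxx (negPf ts) (eq_sym t) (negPf ut) /=.
  by apply/subsetPn; exists u; rewrite !inE ?eqxx ?orbT.
have suvc : collapse [set s; u; v] \notin con_val c.
  rewrite collapse_hook (negPf st) !inE eqxx (negPf ts) !(eq_sym t) (negPf ut)
    (negPf vt) /=.
  by apply/subsetPn; exists u; rewrite !inE ?eqxx ?orbT.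
have bc0 : (b `&` c = \bot)%O by apply: con_chain_meet0.
have acT : (a `|` c = \top)%O.
  have [|aUc //] := hook_coatom hA st (leUr c a).
  by rewrite leUx con_chain_le (negPf suc).
have bcT : (b `|` c = \top)%O.
  by apply/eqP; rewrite -le1x -acT leU2 // ltW.
have cT : covered_by c \top%O.
  split; first by rewrite ltx1; apply: contraNneq suc => ->; apply: collapse_Eq.
  case=> X /andP[cX XT]; case: (hook_coatom hA st (ltW cX)) => [Xc | XE].
    by rewrite (le_gtF Xc) in cX.
  by rewrite XE ltxx in XT.
have [S [Ssub SN5 S0 S1]] : exists S : {pred con_lattice A},
    [/\ sublattice S, isomorphic_to_N5 S, \bot%O \in S & \top%O \in S].
  by rewrite -bc0 -acT; apply: pentagon_sublattice; rewrite // ?bc0 ?acT ?le0x ?lex1.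
split.
- by apply; exists S.
- by apply; exists S.
- move=> /(_ b c); rewrite bc0 bcT => /(_ cT) [_ []]; exists a.
  by rewrite ab andbT; case: (con_chain_atom su1); rewrite ?suT.
pose c' := con_chain (subxx [set s; v]).
pose d := con_chain sv_suv.
have ac'0 : (a `&` c' = \bot)%O.
  by apply: con_chain_meet0; rewrite collapse_con_chain ?su_sv ?suT.
move=> /(_ a c'); rewrite ac'0 => -[| _ []].
  by apply: con_chain_atom; rewrite ?suT.
have [su_in sv_in] : collapse [set s; u] \in con_val (a `|` c')%O /\
                     collapse [set s; v] \in con_val (a `|` c')%O.
  have: (a `|` c' <= a `|` c')%O by [].
  by rewrite leUx !con_chain_le => /andP[/andP[? _] /andP[? _]].
exists d; rewrite !lt_leAnge !con_chain_le !collapse_con_chain //.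
rewrite !eqxx suv_sv suvT sv_in collapse_join //= ?orbT.
apply/negP; rewrite con_leE => /subsetP/(_ _ su_in).
by rewrite collapse_con_chain // su_sv suT eq_sym suv_su.
Qed.
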